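(* Consider the Online Linear Optimization problem with hints on a centrally symmetric convex body $K\subseteq\mathbb{R}^d$ with $B(r)\subseteq K\subseteq B(R)$, where the unit-norm hints satisfy $\langle h_t,g_t\rangle\ge\alpha\|g_t\|_2$ for all $t$. Then for every $\varepsilon>0$ there is an algorithm whose total reward is at least $$(1-\varepsilon)\,\mathrm{OPT} - \frac{d\,G\,R^4}{\alpha\, r^3}\cdot O\!\left(\frac{\log T}{\varepsilon}\right),$$ where $\mathrm{OPT} = \max_{x\in K}\sum_{t=1}^T\langle x,g_t\rangle$ and $G=\max_{g\in\mathcal{G}}\|g\|_2$.
   Context: $B(\rho)$ denotes the Euclidean ball of radius $\rho$ centered at the origin. Online Linear Optimization with hints: a convex body $K$ (playing set), a set $\mathcal{G}$ of gain vectors, and a parameter $\alpha>0$ are given. At each time $t=1,\dots,T$, the algorithm first receives a hint vector $h_t$ with $\|h_t\|_2=1$, then chooses $x_t\in K$ using $g_1,\dots,g_{t-1}$ and $h_1,\dots,h_t$; then a gain vector $g_t\in\mathcal{G}$ satisfying $\langle h_t,g_t\rangle\ge\alpha\|g_t\|_2$ is revealed and the algorithm gains $\langle g_t,x_t\rangle$. Its total reward is $\sum_{t=1}^T\langle g_t,x_t\rangle$. The $O(\cdot)$ hides an absolute constant. *)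

(* Defs.v *)
From HB Require Import structures.
From mathcomp Require Import all_boot all_order all_algebra.
From mathcomp Require Import all_classical all_reals all_analysis.

Set Implicit Arguments.
Unset Strict Implicit.
Unset Printing Implicit Defensive.

Import Order.TTheory GRing.Theory Num.Theory.
Import numFieldNormedType.Exports.

Local Open Scope classical_set_scope.
Local Open Scope ring_scope.

Definition dot (R : realType) (d : nat) (x y : 'rV[R]_d) : R :=
  \sum_(i < d) x ord0 i * y ord0 i.

(* The norm `|x| of mathcomp-analysis on 'rV[R]_d is the sup norm, hence a
   separate Euclidean norm and ball. *)
Definition norm2 (R : realType) (d : nat) (x : 'rV[R]_d) : R :=
  Num.sqrt (dot x x).

Definition ball2 (R : realType) (d : nat) (rho : R) : set 'rV[R]_d :=
  [set x | norm2 x <= rho].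

Arguments ball2 {R} d rho.

Definition is_max (R : realType) (A : set R) (m : R) : Prop :=
  A m /\ ubound A m.

(* Nonempty interior is not required here: it always comes from an inscribed
   ball of positive radius. *)
Definition sym_convex_body (R : realType) (d : nat) (K : set 'rV[R]_d) : Prop :=
  [/\ compact K, convex_set K & forall x, K x -> K (- x)].

(* [A past h] is the point played when [past] lists, in chronological order,
   the pairs (hint, gain vector) of the rounds already completed and [h] is the
   hint of the current round. *)
Definition strategy (R : realType) (d : nat) : Type :=
  seq ('rV[R]_d * 'rV[R]_d) -> 'rV[R]_d -> 'rV[R]_d.

Definition plays_in (R : realType) (d : nat) (A : strategy R d)
    (K : set 'rV[R]_d) : Prop :=
  forall past h, K (A past h).

(* Rounds are numbered from 0: round [t] here is round t+1 in the usual
   numbering, so that T rounds are t = 0, ..., T-1. *)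
Definition play (R : realType) (d : nat) (A : strategy R d)
    (h g : nat -> 'rV[R]_d) (t : nat) : 'rV[R]_d :=
  A [seq (h s, g s) | s <- iota 0 t] (h t).

Definition total_reward (R : realType) (d : nat) (A : strategy R d)
    (h g : nat -> 'rV[R]_d) (T : nat) : R :=
  \sum_(t < T) dot (g t) (play A h g t).

Definition admissible (R : realType) (d : nat) (GG : set 'rV[R]_d) (alpha : R)
    (h g : nat -> 'rV[R]_d) (T : nat) : Prop :=
  forall t, (t < T)%N ->
    [/\ norm2 (h t) = 1, GG (g t) & alpha * norm2 (g t) <= dot (h t) (g t)].

Definition is_OPT (R : realType) (d : nat) (K : set 'rV[R]_d)
    (g : nat -> 'rV[R]_d) (T : nat) (OPT : R) : Prop :=
  is_max [set \sum_(t < T) dot x (g t) | x in K] OPT.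

(* Main.v *)
Require Import Defs.
From HB Require Import structures.
From mathcomp Require Import all_boot all_order all_algebra.
From mathcomp Require Import all_classical all_reals all_analysis.
From mathcomp Require Import ring lra.

Set Implicit Arguments.
Unset Strict Implicit.
Unset Printing Implicit Defensive.

Import Order.TTheory GRing.Theory Num.Theory.
Import numFieldNormedType.Exports.

Local Open Scope classical_set_scope.
Local Open Scope ring_scope.

(** Run projected online gradient ascent [z] on [K] with a constant step [eta],
    and play [(1 - eps) z_t + eps r h_t], which is in [K] by convexity.  The
    second term earns at least [eps r alpha |g_t|] per round, while the regret
    of gradient ascent is at most
    [Rad^2 / (2 eta) + (eta / 2) \sum_t |g_t|^2].  As [|g_t|^2 <= G |g_t|], the
    step [eta = 2 eps r alpha / G] makes the hint term pay for the whole sum,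
    which leaves the constant [G Rad^2 / (4 eps r alpha)], smaller than the
    required bound (it is free of [d] and [ln T]). *)

(** * Euclidean inner product: algebra and continuity *)

Section InnerProduct.
Variables (R : realType) (d : nat).
Implicit Types (x y z : 'rV[R]_d) (a : R).

Lemma dotC x y : dot x y = dot y x.
Proof. by apply: eq_bigr => i _; rewrite mulrC. Qed.

Lemma dotDl x y z : dot (x + y) z = dot x z + dot y z.
Proof. by rewrite -big_split; apply: eq_bigr => i _; rewrite mxE mulrDl. Qed.

Lemma dotZl a x y : dot (a *: x) y = a * dot x y.
Proof. by rewrite /dot mulr_sumr; apply: eq_bigr => i _; rewrite mxE mulrA. Qed.

Lemma dotDr x y z : dot x (y + z) = dot x y + dot x z.
Proof. by rewrite !(dotC x) dotDl. Qed.

Lemma dotZr a x y : dot x (a *: y) = a * dot x y.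
Proof. by rewrite !(dotC x) dotZl. Qed.

Lemma dotNl x y : dot (- x) y = - dot x y.
Proof. by rewrite -scaleN1r dotZl mulN1r. Qed.

Lemma dotNr x y : dot x (- y) = - dot x y.
Proof. by rewrite !(dotC x) dotNl. Qed.

Lemma dot0l x : dot 0 x = 0.
Proof. by rewrite -(scale0r 0) dotZl mul0r. Qed.

Lemma dot_ge0 x : 0 <= dot x x.
Proof. by apply: sumr_ge0 => i _; rewrite -expr2 sqr_ge0. Qed.

Lemma norm2_ge0 x : 0 <= norm2 x.
Proof. exact: sqrtr_ge0. Qed.

Lemma sqr_norm2 x : norm2 x ^+ 2 = dot x x.
Proof. by rewrite sqr_sqrtr ?dot_ge0. Qed.

Lemma norm2Z a x : norm2 (a *: x) = `|a| * norm2 x.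
Proof.
by rewrite /norm2 dotZl dotZr mulrA -expr2 sqrtrM ?sqr_ge0// sqrtr_sqr.
Qed.

Lemma norm2_eq0 x : norm2 x = 0 -> x = 0.
Proof.
move=> x0; have /eqP : dot x x = 0 by rewrite -sqr_norm2 x0 expr0n.
rewrite psumr_eq0 => [/allP xx0|i _]; last by rewrite -expr2 sqr_ge0.
apply/rowP => i; rewrite mxE; apply/eqP.
by have := xx0 i (mem_index_enum i); rewrite mulf_eq0 orbb.
Qed.

Lemma norm20 : norm2 (0 : 'rV[R]_d) = 0.
Proof. by rewrite /norm2 dot0l sqrtr0. Qed.

Lemma continuous_dot (T : topologicalType) (f1 f2 : T -> 'rV[R]_d) :
  continuous f1 -> continuous f2 -> continuous (fun t => dot (f1 t) (f2 t)).
Proof.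
move=> cf1 cf2 t; apply: cvg_big => [|i _]; first exact: add_continuous.
apply: cvgM.
- apply: (@continuous_comp _ _ _ f1 (fun M : 'rV[R]_d => M ord0 i)).
    exact: cf1.
  exact: (@coord_continuous _ _ _ ord0 i (f1 t)).
- apply: (@continuous_comp _ _ _ f2 (fun M : 'rV[R]_d => M ord0 i)).
    exact: cf2.
  exact: (@coord_continuous _ _ _ ord0 i (f2 t)).
Qed.

Lemma continuous_dot_dist (T : topologicalType) (f : T -> 'rV[R]_d) y :
  continuous f -> continuous (fun t => dot (f t - y) (f t - y)).
Proof.
move=> cf.
have -> : (fun t => dot (f t - y) (f t - y)) =
    (fun t => dot (f t) (f t) - dot (f t) (2 *: y) + dot y y).
  apply/funext => t; rewrite !(dotDl, dotDr, dotNl, dotNr, dotZr).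
  by rewrite (dotC y (f t)); ring.
move=> t; apply: cvgD; last exact: cvg_cst.
apply: cvgB; first exact: (continuous_dot cf cf).
by apply: (continuous_dot cf) => ?; exact: cvg_cst.
Qed.

Lemma continuous_sum_dot (T : topologicalType) (f : T -> 'rV[R]_d) n
    (g : nat -> 'rV[R]_d) :
  continuous f -> continuous (fun t => \sum_(i < n) dot (f t) (g i)).
Proof.
move=> cf t; apply: cvg_big => [|i _]; first exact: add_continuous.
by apply: (continuous_dot cf) => ?; exact: cvg_cst.
Qed.

End InnerProduct.

(** * Euclidean projection onto a compact convex set *)

Section Projection.
Variables (R : realType) (d : nat) (K : set 'rV[R]_d).
Hypotheses (cK : compact K) (vK : convex_set K).

Lemma convex_set_comb (x y : 'rV[R]_d) (t : R) :
  K x -> K y -> 0 <= t <= 1 -> K (t *: x + (1 - t) *: y).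
Proof.
move=> Kx Ky /andP[t0 t1].
pose t' : {i01 R} := Itv01 t0 t1.
have := @vK x y t' (mem_set Kx) (mem_set Ky).
by rewrite inE.
Qed.

(** First-order optimality: moving from [p] towards [u] stays in [K], so the squared distance to [y]
    cannot drop, and its slope at [p] cannot be negative. *)
Lemma closest_point_obtuse (p y u : 'rV[R]_d) :
  K p -> (forall x, K x -> dot (p - y) (p - y) <= dot (x - y) (x - y)) ->
  K u -> 0 <= dot (p - y) (u - p).
Proof.
move=> Kp pmin Ku; set a := dot _ _; pose b := dot (u - p) (u - p).
have b0 : 0 <= b := dot_ge0 _.
have quad t : 0 <= t <= 1 -> 0 <= t ^+ 2 * b + 2 * t * a.
  move=> t01; have := pmin _ (convex_set_comb Ku Kp t01).
  have -> : t *: u + (1 - t) *: p - y = (p - y) + t *: (u - p).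
    by apply/rowP => i; rewrite !mxE; ring.
  rewrite /a /b; move: (p - y) (u - p) => w v.
  by rewrite !(dotDl, dotDr, dotZl, dotZr) (dotC v w); lra.
rewrite leNgt; apply/negP => a0.
have ba : 0 < b - a by lra.
(* The unconstrained minimiser [- a / b] may exceed 1, or [b] may vanish; with [b - a] as
   denominator the point stays in the unit interval and the quadratic is still negative there. *)
have t01 : 0 <= - a / (b - a) <= 1.
  by rewrite ler_pdivlMr ?ler_pdivrMr//; apply/andP; split; lra.
have := quad _ t01.
have -> : (- a / (b - a)) ^+ 2 * b + 2 * (- a / (b - a)) * a =
    a ^+ 2 * (2 * a - b) / (b - a) ^+ 2 by field; rewrite gt_eqF.
apply/negP; rewrite -ltNge ltr_pdivrMr ?mul0r ?exprn_gt0//.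
by rewrite pmulr_rlt0 ?exprn_even_gt0//= ?lt_eqF//; lra.
Qed.

(** The property kept is the one the regret bound uses: projecting brings a point no farther from
    any [u] in [K]. Expanding around a closest point, the cross term is nonnegative by the obtuse
    angle. *)
Lemma projection_exists : K !=set0 -> exists p : 'rV[R]_d -> 'rV[R]_d,
  forall y, K (p y) /\
    forall u, K u -> dot (u - p y) (u - p y) <= dot (u - y) (u - y).
Proof.
move=> K0.
suff near y : exists p, K p /\
    forall u, K u -> dot (u - p) (u - p) <= dot (u - y) (u - y).
  by have [p pP] := boolp.choice near; exists p.
have cdist := continuous_dot_dist (y := y) (fun x : 'rV[R]_d => @cvg_id _ (nbhs x)).
have [p /set_mem Kp pmin] := EVT_min_rV K0 cK (continuous_subspaceT cdist).
exists p; split=> // u Ku.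
have := closest_point_obtuse Kp (fun x Kx => pmin x (mem_set Kx)) Ku.
have -> : u - y = (u - p) + (p - y) by apply/rowP => i; rewrite !mxE; ring.
move: (p - y) (u - p) => w v; have := dot_ge0 w.
by rewrite !(dotDl, dotDr) (dotC v w); lra.
Qed.

End Projection.

(** * Regret of projected gradient ascent *)

Section GradientAscent.
Variables (R : realType) (d : nat) (K : set 'rV[R]_d).
Variables (p : 'rV[R]_d -> 'rV[R]_d) (eta : R).
Hypothesis p_proj : forall y u, K u ->
  dot (u - p y) (u - p y) <= dot (u - y) (u - y).

(** The squared distance from [z t] to [u] is a potential: each round it decreases by at least the
    summand, and the sum telescopes. *)
Lemma gradient_ascent_regret (z g : nat -> 'rV[R]_d) (u : 'rV[R]_d) (T : nat) :
  (forall t, z t.+1 = p (z t + eta *: g t)) -> K u ->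
  \sum_(t < T) (2 * eta * (dot (g t) u - dot (g t) (z t))
                - eta ^+ 2 * dot (g t) (g t))
    <= dot (u - z 0%N) (u - z 0%N).
Proof.
move=> zS Ku.
(* The induction needs the final potential, which the statement drops. *)
apply: (@le_trans _ _ (dot (u - z 0%N) (u - z 0%N) - dot (u - z T) (u - z T)));
  last by rewrite gerBl dot_ge0.
elim: T => [|T IH]; first by rewrite big_ord0 subrr.
rewrite big_ord_recr /=; have := p_proj (z T + eta *: g T) Ku.
rewrite -zS.
have -> : u - (z T + eta *: g T) = (u - z T) + (- eta) *: g T.
  by apply/rowP => i; rewrite !mxE; ring.
have -> : dot (g T) u - dot (g T) (z T) = dot (g T) (u - z T).
  by rewrite dotDr dotNr.
move: IH; move: (u - z T) => w.
by rewrite !(dotDl, dotDr, dotZl, dotZr) (dotC w (g T)); lra.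
Qed.

End GradientAscent.

(** * The strategies and their rewards *)

Section Strategies.
Variables (R : realType) (d : nat).
Implicit Types (K : set 'rV[R]_d).

Lemma OPT_exists K (g : nat -> 'rV[R]_d) (T : nat) :
  compact K -> K !=set0 ->
  exists2 u, K u & is_OPT K g T (\sum_(t < T) dot u (g t)).
Proof.
move=> cK K0.
have cgain := continuous_sum_dot (n := T) (g := g) (fun x : 'rV[R]_d => @cvg_id _ (nbhs x)).
have [u /set_mem Ku umax] := EVT_max_rV K0 cK (continuous_subspaceT cgain).
exists u => //; split; first by exists u.
by move=> _ [x Kx <-]; exact/umax/mem_set.
Qed.

(* [plays_in] quantifies over all [h], so hints that are too long must be mapped
   into the ball as well. *)
Definition hint_point (r : R) (h : 'rV[R]_d) : 'rV[R]_d :=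
  if norm2 h <= 1 then r *: h else 0.

Lemma hint_point_ball r h : 0 <= r -> norm2 (hint_point r h) <= r.
Proof.
move=> r0; rewrite /hint_point; case: ifPn => h1; last by rewrite norm20.
by rewrite norm2Z ger0_norm// ler_piMr.
Qed.

(** A strategy carries no state, so the iterate is replayed from the history, starting at the
    origin. *)
Definition ascent_iterate (p : 'rV[R]_d -> 'rV[R]_d) (eta : R)
    (past : seq ('rV[R]_d * 'rV[R]_d)) : 'rV[R]_d :=
  foldl (fun z hg => p (z + eta *: hg.2)) 0 past.

Lemma ascent_iterateS p eta (h g : nat -> 'rV[R]_d) t :
  ascent_iterate p eta [seq (h s, g s) | s <- iota 0 t.+1] =
  p (ascent_iterate p eta [seq (h s, g s) | s <- iota 0 t] + eta *: g t).
Proof. by rewrite /ascent_iterate -(addn1 t) iotaD map_cat foldl_cat. Qed.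

Lemma ascent_iterate_in K p eta past :
  K 0 -> (forall y, K (p y)) -> K (ascent_iterate p eta past).
Proof.
move=> K0 Kp; elim/last_ind: past => [//|past hg _].
by rewrite /ascent_iterate foldl_rcons; exact: Kp.
Qed.

Definition hinted_ascent (p : 'rV[R]_d -> 'rV[R]_d) (r eps eta : R) :
    strategy R d :=
  fun past h => (1 - eps) *: ascent_iterate p eta past + eps *: hint_point r h.

Lemma hinted_ascent_reward K p (Rad r alpha G eps : R)
    (h g : nat -> 'rV[R]_d) (T : nat) (u : 'rV[R]_d) :
  (forall y u, K u -> dot (u - p y) (u - p y) <= dot (u - y) (u - y)) ->
  0 < r -> 0 < alpha -> 0 < G -> 0 < eps < 1 -> K u -> norm2 u <= Rad ->
  (forall t, (t < T)%N -> [/\ norm2 (h t) = 1, norm2 (g t) <= G &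
    alpha * norm2 (g t) <= dot (h t) (g t)]) ->
  (1 - eps) * (\sum_(t < T) dot u (g t)) - G * Rad ^+ 2 / (4 * eps * r * alpha)
    <= total_reward (hinted_ascent p r eps (2 * eps * r * alpha / G)) h g T.
Proof.
move=> p_proj r0 alpha0 G0 /andP[eps0 eps1] Ku uRad adm.
set eta := 2 * eps * r * alpha / G.
have eta0 : 0 < eta by rewrite divr_gt0// !mulr_gt0.
have etaG : eta * G = 2 * eps * r * alpha by rewrite /eta divfK// gt_eqF.
pose z t := ascent_iterate p eta [seq (h s, g s) | s <- iota 0 t].
have regret := gradient_ascent_regret p_proj T (ascent_iterateS p eta h g) Ku.
have uu : dot (u - z 0%N) (u - z 0%N) <= Rad ^+ 2.
  rewrite [z 0%N]/(0 : 'rV[R]_d) subr0 -sqr_norm2 ler_pXn2r ?nnegrE//.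
    exact: norm2_ge0.
  exact: le_trans (norm2_ge0 _) uRad.
(* The shortfall against [(1 - eps) *: u], scaled by [2 * eta], is at most [1 - eps] times the
   regret sum, round by round. *)
have bound : \sum_(t < T) 2 * eta *
    ((1 - eps) * dot u (g t)
     - dot (g t) (play (hinted_ascent p r eps eta) h g t))
    <= (1 - eps) * Rad ^+ 2.
  have eps1' : 0 <= 1 - eps by lra.
  apply: le_trans _ (ler_wpM2l eps1' (le_trans regret uu)).
  rewrite mulr_sumr; apply: ler_sum => t _.
  have [ht1 gtG hgt] := adm t (ltn_ord t).
  rewrite /play /hinted_ascent /hint_point ht1 lexx dotDr !dotZr -/(z t).
  rewrite (dotC (g t) (h t)) (dotC u) -sqr_norm2.
  set n := norm2 (g t) in gtG hgt *.
  have n0 : 0 <= n := norm2_ge0 _.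
  (* Here the choice of [eta] acts: with [n <= G], the quadratic regret term is at most twice the
     guaranteed hint gain. *)
  have h1 : eta * n ^+ 2 <= 2 * eps * r * (alpha * n).
    rewrite mulrA -etaG -mulrA ler_pM2l// expr2; exact: ler_wpM2r.
  have h2 : 2 * eps * r * (alpha * n) <= 2 * eps * r * dot (h t) (g t).
    by rewrite ler_pM2l// !mulr_gt0.
  have h3 : eta * (eta * n ^+ 2) <= eta * (2 * eps * r * dot (h t) (g t)).
    by rewrite ler_pM2l// (le_trans h1).
  (* Only the fraction [1 - eps] of the quadratic term has to be paid, while [h3] pays for all of
     it; this is the surplus. *)
  have h4 : 0 <= eps * (eta * (eta * n ^+ 2)).
    by rewrite pmulr_rge0// pmulr_rge0// pmulr_rge0// sqr_ge0.
  by move: h3 h4; lra.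
have e4 : G * Rad ^+ 2 / (4 * eps * r * alpha) = Rad ^+ 2 / (2 * eta).
  by rewrite /eta; field; rewrite !gt_eqF.
rewrite e4 lerBlDr -lerBlDl ler_pdivlMr; last lra.
rewrite mulr_sumr -sumrB mulr_suml.
apply: (@le_trans _ _ ((1 - eps) * Rad ^+ 2)).
  apply: le_trans _ bound; apply: ler_sum => t _; lra.
by rewrite ler_piMl ?sqr_ge0//; lra.
Qed.

(** Fallback for the degenerate cases [1 <= eps] and [G = 0], where a nonnegative reward is
    enough. *)
Lemma hint_only_reward (r alpha : R) (h g : nat -> 'rV[R]_d) (T : nat) :
  0 <= r -> 0 <= alpha ->
  (forall t, (t < T)%N ->
    norm2 (h t) = 1 /\ alpha * norm2 (g t) <= dot (h t) (g t)) ->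
  0 <= total_reward (fun _ => hint_point r) h g T.
Proof.
move=> r0 alpha0 adm; apply: sumr_ge0 => t _.
have [ht1 hgt] := adm t (ltn_ord t).
rewrite /play /hint_point ht1 lexx dotZr dotC mulr_ge0//.
by apply: le_trans _ hgt; rewrite mulr_ge0 ?norm2_ge0.
Qed.

End Strategies.

(** * Comparison with the required bound, and the theorem *)

Lemma constant_le_log_bound (R : realType) (d T : nat)
    (r Rad alpha G eps : R) :
  (0 < d)%N -> (2 <= T)%N -> 0 < r -> r <= Rad -> 0 < alpha -> 0 <= G ->
  0 < eps ->
  G * Rad ^+ 2 / (4 * eps * r * alpha) <=
  (d%:R * G * Rad ^+ 4) / (alpha * r ^+ 3) * ((ln 2)^-1 * (ln T%:R / eps)).
Proof.
move=> d0 T2 r0 rRad alpha0 G0 eps0.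
have ln2 : 0 < ln (2 : R) by rewrite ln_gt0// ltr1n.
have lnT : 1 <= (ln 2)^-1 * ln T%:R :> R.
  rewrite mulrC ler_pdivlMr// mul1r ler_ln ?posrE ?ler_nat ?ltr0n//.
  exact: leq_trans T2.
have d1 : 1 <= d%:R :> R by rewrite ler1n.
have c0 : 0 <= G * Rad ^+ 2 / (eps * r * alpha).
  apply: divr_ge0; first by rewrite mulr_ge0 ?sqr_ge0.
  by rewrite ltW// !mulr_gt0.
have ratio : 1 <= (Rad / r) ^+ 2.
  by rewrite exprn_ege1// ler_pdivlMr ?mul1r.
have -> : G * Rad ^+ 2 / (4 * eps * r * alpha) =
    G * Rad ^+ 2 / (eps * r * alpha) * 4^-1 by field; rewrite !gt_eqF.
have -> : d%:R * G * Rad ^+ 4 / (alpha * r ^+ 3) *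
    ((ln 2)^-1 * (ln T%:R / eps)) =
    G * Rad ^+ 2 / (eps * r * alpha) *
    (d%:R * (Rad / r) ^+ 2 * ((ln 2)^-1 * ln T%:R)).
  by field; rewrite !gt_eqF.
(* After removing the common factor, 1/4 is compared with a product of three factors, each at least
   1. *)
rewrite ler_wpM2l//; apply: (@le_trans _ _ 1); first lra.
by rewrite mulr_ege1// mulr_ege1.
Qed.

Theorem theorem8 (R : realType) :
  exists2 C : R, 0 < C &
  forall (d : nat) (K GG : set 'rV[R]_d) (r Rad alpha G eps : R),
    sym_convex_body K ->
    0 < r -> ball2 d r `<=` K -> K `<=` ball2 d Rad ->
    is_max [set norm2 g | g in GG] G ->
    0 < alpha -> 0 < eps ->
    exists2 A : strategy R d, plays_in A K &
    forall (T : nat) (h g : nat -> 'rV[R]_d),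
      (2 <= T)%N ->
      admissible GG alpha h g T ->
      exists2 OPT : R, is_OPT K g T OPT &
        (1 - eps) * OPT
          - (d%:R * G * Rad ^+ 4) / (alpha * r ^+ 3) * (C * (ln T%:R / eps))
        <= total_reward A h g T.
Proof.
(* This constant turns [ln T] into the base 2 logarithm, which is at least 1 as soon as [2 <= T]. *)
exists (ln 2)^-1; first by rewrite invr_gt0 ln_gt0// ltr1n.
move=> d K GG r Rad alpha G eps [cK vK _] r0 rK KRad [[g0 _ g0G] Gmax].
move=> alpha0 eps0.
have G0 : 0 <= G by rewrite -g0G norm2_ge0.
have K0 : K 0 by apply: rK; rewrite /ball2 /= norm20 ltW.
have Kne : K !=set0 by exists 0.
have Khint h : K (hint_point r h) by apply: rK; exact/hint_point_ball/ltW.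
have bounded h g T : admissible GG alpha h g T -> forall t, (t < T)%N ->
    [/\ norm2 (h t) = 1, norm2 (g t) <= G &
        alpha * norm2 (g t) <= dot (h t) (g t)].
  by move=> adm t /adm[ht gt hgt]; split => //; apply: Gmax; exists (g t).
have slack h g T : (2 <= T)%N -> admissible GG alpha h g T ->
    G * Rad ^+ 2 / (4 * eps * r * alpha) <=
    (d%:R * G * Rad ^+ 4) / (alpha * r ^+ 3) * ((ln 2)^-1 * (ln T%:R / eps)).
  (* The unit hint of round 0 forces [0 < d], since all norms vanish in dimension 0, and [r <= Rad],
     since [r *: h 0] lies in [K]. *)
  move=> T2 /(_ 0%N (ltn_trans _ T2))[]// h1 _ _.
  apply: constant_le_log_bound => //.
    rewrite lt0n; apply/negP => /eqP d0.
    move/eqP: h1; rewrite /norm2 /dot big1 => [|i _].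
      by rewrite sqrtr0 eq_sym oner_eq0.
    by exfalso; have := ltn_ord i; rewrite [X in (_ < X)%N]d0.
  have := KRad _ (Khint (h 0%N)); rewrite /ball2 /= /hint_point h1 lexx.
  by rewrite norm2Z h1 mulr1 gtr0_norm.
have B0 : 0 <= G * Rad ^+ 2 / (4 * eps * r * alpha).
  apply: divr_ge0; first by rewrite mulr_ge0 ?sqr_ge0.
  by rewrite ltW// !mulr_gt0.
(* The step size divides by [G] and the mixture needs [eps < 1]. Otherwise [(1 - eps) * OPT <= 0]:
   either the factor is nonpositive and [OPT] is nonnegative because [K 0], or all gains vanish. *)
have [/andP[eps1 Gpos]|trivial] := boolP ((eps < 1) && (0 < G)); last first.
  exists (fun _ => hint_point r) => [past h|T h g T2 adm]; first exact: Khint.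
  have [u Ku OPTu] := OPT_exists g T cK Kne.
  exists (\sum_(t < T) dot u (g t)) => //.
  apply: (@le_trans _ _ 0); last first.
    by apply: (hint_only_reward (ltW r0) (ltW alpha0)) => t /(bounded h g T adm)[].
  rewrite subr_le0; apply: le_trans _ (slack h g T T2 adm); apply: le_trans _ B0.
  have OPT0 : 0 <= \sum_(t < T) dot u (g t).
    apply: OPTu.2; exists 0 => //.
    by rewrite big1// => t _; rewrite dot0l.
  move: trivial; rewrite negb_and -!leNgt => /orP[eps1|Gle0].
    by rewrite mulr_le0_ge0// subr_le0.
  rewrite big1 ?mulr0// => t _.
  have [_ gtG _] := bounded h g T adm t (ltn_ord t).
  rewrite dotC (norm2_eq0 (x := g t)) ?dot0l//.
  by apply/eqP; rewrite eq_le norm2_ge0 (le_trans gtG).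
have [p p_proj] := projection_exists cK vK Kne.
exists (hinted_ascent p r eps (2 * eps * r * alpha / G)) => [past h|T h g T2 adm].
  rewrite /hinted_ascent addrC -{1}(subKr 1 eps).
  have := convex_set_comb vK (Khint h) (ascent_iterate_in
    (2 * eps * r * alpha / G) past K0 (fun y => (p_proj y).1)).
  by move=> /(_ eps); rewrite subKr; apply; rewrite !ltW.
have [u Ku OPTu] := OPT_exists g T cK Kne.
exists (\sum_(t < T) dot u (g t)) => //.
apply: le_trans _ (hinted_ascent_reward (fun y => (p_proj y).2) r0 alpha0 Gpos _
  Ku (KRad _ Ku) (bounded h g T adm)); last by rewrite eps0.
by rewrite lerD2l lerN2 (slack h g).
Qed.
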